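(* If $G$ is a (finite, simple) bipartite graph without isolated vertices, then $\chi'_{sCF}(G)\leq 3$.
   Context: For a graph $H$ and a vertex $v$, let $E_H(v)$ be the set of edges of $H$ incident to $v$, and for a pair $u,v$ let $E_H[uv]=E_H(u)\cup E_H(v)$. Given a graph $G$ and an edge colouring $c$ (not necessarily proper) of some subgraph $H$ of $G$, an edge $e$ of $G$ is satisfied by $c$ if the multiset $\{c(e'): e'\in E_H[e]\}$ contains a colour occurring exactly once in it. The parameter $\chi'_{sCF}(G)$ is the least number of colours for which there exist a subgraph $H$ of $G$ and an edge colouring of $H$ with that many colours satisfying every edge of $G$. *)

(* Defs.v *)
From mathcomp Require Import all_boot.
Set Implicit Arguments.
Unset Strict Implicit.
Unset Printing Implicit Defensive.

Record sgraph := SGraph {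
  vertex : finType;
  adj : rel vertex;
  adj_sym : symmetric adj;
  adj_irrefl : irreflexive adj }.

Section Graph.
Variable G : sgraph.
Local Notation V := (vertex G).

Definition edges : {set {set V}} :=
  [set [set p.1; p.2] | p : V * V & adj p.1 p.2].

Definition no_isolated_vertex : Prop := forall x : V, exists y : V, adj x y.

Definition bipartite : Prop :=
  exists A : {set V}, forall x y : V, adj x y -> (x \in A) != (y \in A).

(* A candidate subgraph is a pair (vertex set, edge set). *)
Definition is_subgraph (H : {set V} * {set {set V}}) : bool :=
  (H.2 \subset edges) && [forall e in H.2, e \subset H.1].

Definition incident_edges (H : {set V} * {set {set V}}) (v : V) :
    {set {set V}} := [set e in H.2 | v \in e].

Definition pair_edges (H : {set V} * {set {set V}}) (u v : V) :
    {set {set V}} := incident_edges H u :|: incident_edges H v.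

Local Notation edge_of H := {e : {set V} | e \in H.2}.

(* Multisets of colours are represented by sequences, up to order. *)
Definition pair_colours (H : {set V} * {set {set V}}) (k : nat)
    (c : {ffun edge_of H -> 'I_k}) (u v : V) : seq 'I_k :=
  [seq c e | e : edge_of H in [pred e | sval e \in pair_edges H u v]].

Definition satisfied (H : {set V} * {set {set V}}) (k : nat)
    (c : {ffun edge_of H -> 'I_k}) (u v : V) : bool :=
  [exists a : 'I_k, count_mem a (pair_colours c u v) == 1].

Definition sCF_colourable (k : nat) : bool :=
  [exists H : {set V} * {set {set V}}, is_subgraph H &&
    [exists c : {ffun edge_of H -> 'I_k},
      [forall u : V, forall v : V, adj u v ==> satisfied c u v]]].

(* Colouring all edges of G with distinct colours satisfies every edge. *)
Lemma sCF_colourable_ex : exists k, sCF_colourable k.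
Proof.
pose H := ([set: V], edges).
exists #|{: edge_of H}|; apply/existsP; exists H; apply/andP; split.
  by rewrite /is_subgraph subxx; apply/forall_inP => e _; rewrite subsetT.
apply/existsP; exists [ffun e => enum_rank e].
apply/forallP => u; apply/forallP => v; apply/implyP => auv.
have eP : [set u; v] \in H.2 by apply/imsetP; exists (u, v); rewrite ?inE.
pose e0 : edge_of H := exist (fun e => e \in H.2) _ eP.
apply/existsP; exists (enum_rank e0).
rewrite /pair_colours count_uniq_mem.
  suff -> : enum_rank e0 \in
      [seq [ffun e => enum_rank e] e
        | e : edge_of H in [pred e | sval e \in pair_edges H u v]] by [].
  apply/imageP; exists e0; last by rewrite ffunE.
  by rewrite inE /= /pair_edges /incident_edges !inE /= eP !eqxx.
rewrite map_inj_uniq ?enum_uniq // => x y.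
by rewrite !ffunE => /enum_rank_inj.
Qed.

Definition chi_sCF : nat := ex_minn sCF_colourable_ex.

End Graph.

(* Main.v *)
(** Let [A], [B] be the two sides and let [S] be a minimal subset of [A] that
    dominates [B].  By minimality each [s] in [S] has a private neighbour [p s]
    in [B], whose only neighbour in [S] is [s].  Let [H] consist of one edge
    from each [b] in [B] to [S], and give one colour to the edges [s (p s)] and
    a second colour to the rest.  An edge [ab] with [a] outside [S] meets
    exactly one edge of [H].  An edge [sb] with [s] in [S] meets [s (p s)], and
    no other edge of the first colour: such an edge would be [t (p t)] with
    [t <> s], so [b = p t], which is not adjacent to [s].  Hence two colours
    suffice. *)
Require Import Defs.
From mathcomp Require Import all_boot.
Set Implicit Arguments.
Unset Strict Implicit.
Unset Printing Implicit Defensive.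

Section ConflictFreeColouring.
Variable G : sgraph.
Local Notation V := (vertex G).
Implicit Types (H : {set V} * {set {set V}}) (B S : {set V}) (u v : V).

Lemma chi_sCF_leq k : sCF_colourable G k -> chi_sCF G <= k.
Proof. by rewrite /chi_sCF; case: ex_minnP => m _; apply. Qed.

Definition colour_class H k (col : {set V} -> 'I_k) u v (i : 'I_k) :
    {set {set V}} :=
  [set e in pair_edges H u v | col e == i].

Lemma colour_classC H k (col : {set V} -> 'I_k) u v i :
  colour_class H col u v i = colour_class H col v u i.
Proof. by rewrite /colour_class /pair_edges setUC. Qed.

Lemma count_pair_colours H k (col : {set V} -> 'I_k) u v i :
  count_mem i (pair_colours [ffun e : {e | e \in H.2} => col (sval e)] u v) =
  #|colour_class H col u v i|.
Proof.
rewrite /pair_colours count_map -size_filter -filter_predI -cardE.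
rewrite -(card_image val_inj); apply: eq_card => e; rewrite in_set.
apply/imageP/andP => [[e' /andP[/= col_e' eP'] ->] | [eP col_e]].
  by rewrite ffunE in col_e'.
have eH : e \in H.2 by move: eP; rewrite !inE => /orP[] /andP[].
by exists (exist _ e eH) => //; apply/andP; rewrite /= ffunE.
Qed.

Lemma sCF_colourable_singleton_class H k (col : {set V} -> 'I_k) :
    is_subgraph H ->
    (forall u v, adj u v -> exists i, #|colour_class H col u v i| = 1) ->
  sCF_colourable G k.
Proof.
move=> subH col1; apply/existsP; exists H; rewrite subH /=.
apply/existsP; exists [ffun e => col (sval e)].
apply/forallP=> u; apply/forallP=> v; apply/implyP=> /col1[i class1].
by apply/existsP; exists i; rewrite count_pair_colours class1.
Qed.

Definition dominates S B : bool := [forall b in B, exists s in S, adj s b].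

Definition private_neighbour S s b : bool :=
  [set t in S | adj t b] == [set s].

Lemma minset_dominates_private B S s :
    minset (dominates^~ B) S -> s \in S ->
  exists2 b, b \in B & private_neighbour S s b.
Proof.
case/minsetP=> /forall_inP domS minS sS.
have /forall_inPn[b bB /exists_inPn undom_b] : ~~ dominates (S :\ s) B.
  apply/negP=> /minS/(_ (subsetDl _ _))/setP/(_ s).
  by rewrite !inE eqxx sS.
have only_s t : t \in S -> adj t b -> t = s.
  move=> tS; apply: contraTeq => ts.
  by apply: undom_b; rewrite !inE ts.
exists b => //; apply/eqP/setP => t; rewrite !inE.
apply/andP/eqP => [[] | ->]; first exact: only_s.
have /exists_inP[r rS rb] := domS b bB.
by rewrite -(only_s r).
Qed.

Definition dominator S b : V := odflt b [pick s in S | adj s b].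

Lemma dominatorP S B b :
  dominates S B -> b \in B -> dominator S b \in S /\ adj (dominator S b) b.
Proof.
move=> /forall_inP domS /domS/exists_inP[s sS sb].
rewrite /dominator; case: pickP => [t /andP[] // | /(_ s)].
by rewrite sS sb.
Qed.

Definition chosen_private S B s : V :=
  odflt s [pick b in B | private_neighbour S s b].

Lemma chosen_privateP B S s :
    minset (dominates^~ B) S -> s \in S ->
  chosen_private S B s \in B /\ private_neighbour S s (chosen_private S B s).
Proof.
move=> minS /(minset_dominates_private minS)[b bB pb].
rewrite /chosen_private; case: pickP => [c /andP[] // | /(_ b)].
by rewrite bB pb.
Qed.

Section StarForest.
Variables (B S : {set V}).
Hypothesis minS : minset (dominates^~ B) S.
Hypothesis disjSB : [disjoint S & B].

Local Notation p := (chosen_private S B).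
Local Notation P := (p @: S).

Definition star_edge b : {set V} := [set dominator S b; b].
Definition star_forest : {set V} * {set {set V}} :=
  ([set: V], star_edge @: B).
Definition star_colour (e : {set V}) : 'I_2 :=
  if [disjoint e & P] then ord0 else ord_max.
Definition leaf_colour b : 'I_2 := if b \in P then ord_max else ord0.
Definition pair_leaves a b : {set V} :=
  [set x in B | (dominator S x == a) || (x == b)].

Let domS : dominates S B. Proof. exact: minsetp minS. Qed.

Lemma dominator_notin b : b \in B -> dominator S b \notin B.
Proof. by case/(dominatorP domS) => fS _; rewrite (disjointFr disjSB). Qed.

Lemma star_forest_subgraph : is_subgraph star_forest.
Proof.
apply/andP; split; last by apply/forall_inP=> e _; apply: subsetT.
apply/subsetP=> _ /imsetP[b /(dominatorP domS)[_ fb] ->].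
by apply/imsetP; exists (dominator S b, b); rewrite ?inE.
Qed.

Lemma pair_edges_star_forest a b : a \notin B -> b \in B ->
  pair_edges star_forest a b = star_edge @: pair_leaves a b.
Proof.
move=> aB bB; apply/setP=> e; rewrite !inE -andb_orr.
have ends x : x \in B ->
    (a \in star_edge x) || (b \in star_edge x) =
    (dominator S x == a) || (x == b).
  move=> xB; have aNx := memPnC aB x xB.
  have bNx := memPn (dominator_notin xB) b bB.
  by rewrite !inE (negPf aNx) (negPf bNx) orbF (eq_sym a) (eq_sym b).
apply/andP/imsetP => [[/imsetP[x xB ->]] | [x]].
  by rewrite ends // => xab; exists x; rewrite ?inE ?xB.
by rewrite inE => /andP[xB xab] ->; rewrite imset_f ?ends.
Qed.

Lemma star_colour_edge b : b \in B ->
  star_colour (star_edge b) = leaf_colour b.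
Proof.
move=> bB; rewrite /star_colour /leaf_colour.
rewrite -setI_eq0 setIUl setU_eq0 !setI_eq0.
have PB : P \subset B.
  by apply/subsetP=> _ /imsetP[s /(chosen_privateP minS)[pB _] ->].
rewrite !disjoints1 (contra (subsetP PB _) (dominator_notin bB)) /=.
by case: (b \in P).
Qed.

Lemma card_colour_class_star_forest a b x i : a \notin B -> b \in B ->
    [set y in pair_leaves a b | leaf_colour y == i] = [set x] ->
  #|colour_class star_forest star_colour a b i| = 1.
Proof.
move=> aB bB class_x.
suff -> : colour_class star_forest star_colour a b i =
    star_edge @: [set y in pair_leaves a b | leaf_colour y == i].
  by rewrite class_x imset_set1 cards1.
apply/setP=> e; rewrite inE pair_edges_star_forest //.
have col_leaf y : y \in pair_leaves a b ->
    star_colour (star_edge y) = leaf_colour y.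
  by rewrite inE => /andP[yB _]; apply: star_colour_edge.
apply/andP/imsetP => [[/imsetP[y ly ->]] | [y]].
  by rewrite col_leaf // => col_y; exists y; rewrite // inE ly.
by rewrite inE => /andP[ly col_y] ->; rewrite imset_f ?col_leaf.
Qed.

Lemma adj_chosen_private s t :
  s \in S -> t \in S -> adj t (p s) = (t == s).
Proof.
move=> sS tS; have [_ /eqP/setP/(_ t)] := chosen_privateP minS sS.
by rewrite !inE tS.
Qed.

Lemma dominator_chosen_private s : s \in S -> dominator S (p s) = s.
Proof.
move=> sS; have [pB _] := chosen_privateP minS sS.
have [fS] := dominatorP domS pB.
by rewrite adj_chosen_private // => /eqP.
Qed.

Lemma card_colour_class_undominating a b :
    a \notin B -> a \notin S -> b \in B ->
  exists i, #|colour_class star_forest star_colour a b i| = 1.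
Proof.
move=> aB aS bB; exists (leaf_colour b).
apply: (@card_colour_class_star_forest _ _ b) => //.
apply/setP=> x; rewrite !inE.
apply/andP/eqP => [[/andP[xB /orP[/eqP xa | /eqP //]] _] | ->].
  by have [] := dominatorP domS xB; rewrite xa (negPf aS).
by rewrite bB !eqxx orbT.
Qed.

Lemma card_colour_class_dominating s b : s \in S -> b \in B -> adj s b ->
  exists i, #|colour_class star_forest star_colour s b i| = 1.
Proof.
move=> sS bB sb; exists ord_max.
apply: (@card_colour_class_star_forest _ _ (p s)) => //.
  by rewrite (disjointFr disjSB).
have [pB _] := chosen_privateP minS sS.
apply/setP=> x; rewrite !inE /leaf_colour.
apply/andP/eqP => [[/andP[xB xsb]] | ->]; last first.
  by rewrite dominator_chosen_private // pB imset_f // !eqxx.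
case: imsetP => // -[t tS x_pt] _.
have sx : adj s x.
  by case/orP: xsb => /eqP; [case: (dominatorP domS xB) => _ ? <- | move->].
by move: sx; rewrite x_pt adj_chosen_private // => /eqP ->.
Qed.

End StarForest.

Lemma bipartite_chi_sCF_leq2 :
  bipartite G -> no_isolated_vertex G -> chi_sCF G <= 2.
Proof.
case=> A bipA noiso.
have domA : dominates A (~: A).
  apply/forall_inP=> b; rewrite inE => bA; have [a ba] := noiso b.
  apply/exists_inP; exists a; last by rewrite adj_sym.
  by have := bipA _ _ ba; rewrite (negPf bA); case: (a \in A).
have [S minS SA] := minset_exists (P := dominates^~ (~: A)) domA.
have disjSB : [disjoint S & ~: A] by rewrite disjoints_subset setCK.
apply: chi_sCF_leq.
apply: sCF_colourable_singleton_class (star_forest_subgraph minS) _ => u v uv.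
wlog [uA vA] : u v uv / u \notin ~: A /\ v \in ~: A.
  move=> crossing; have := bipA _ _ uv.
  have [uA | uA] := boolP (u \in A); have [vA | vA] := boolP (v \in A) => // _.
    by apply: crossing; rewrite ?inE ?uA ?vA.
  have [||i] := crossing v u; rewrite ?inE ?uA ?vA 1?adj_sym //.
  by rewrite colour_classC; exists i.
have [uS | uS] := boolP (u \in S).
  exact: card_colour_class_dominating.
exact: card_colour_class_undominating.
Qed.

End ConflictFreeColouring.

Theorem theorem1 (G : sgraph) (hbip : bipartite G)
  (hiso : no_isolated_vertex G) : chi_sCF G <= 3.
Proof. exact: leq_trans (bipartite_chi_sCF_leq2 hbip hiso) _. Qed.
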